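(* There is a polynomial $p$ such that every satisfiable sentence $\varphi$ of the triguarded fragment $\mathrm{TGF}$ (with or without constants) has a finite model with at most $2^{2^{p(|\varphi|)}}$ elements. The same holds for every sentence $\varphi$ of the guarded fragment with universal role $\mathrm{GFU}$: if $\varphi$ has a $\mathsf{U}$-biquitous model, then it has a finite $\mathsf{U}$-biquitous model with at most $2^{2^{p(|\varphi|)}}$ elements.
   Context: Signatures consist of relation symbols of arbitrary positive arity and possibly constant symbols (no function symbols of positive arity); $|\varphi|$ denotes the length of $\varphi$. The guarded fragment GF is the least set of formulas containing all atomic formulas, closed under $\vee,\wedge,\neg,\Rightarrow,\Leftrightarrow$, and such that if $\psi(\bar x,\bar y)\in\mathrm{GF}$ then $\forall\bar x(\gamma(\bar x,\bar y)\Rightarrow\psi(\bar x,\bar y))$ and $\exists\bar x(\gamma(\bar x,\bar y)\wedge\psi(\bar x,\bar y))$ are in GF, where $\gamma$ (the guard) is an atomic formula containing all free variables of $\psi$; quantification of subformulas with at most one free variable may be left unguarded (formally, guarded by $x=x$). The triguarded fragment TGF consists of the formulas built by the same rules but without equality (except trivial guards $x=x$), together with the additional rule: if $\psi(x,y)$ is in TGF (at most the free variables $x,y$), then $\exists x\,\psi(x,y)$ and $\forall x\,\psi(x,y)$ are in TGF. GFU: signatures contain a distinguished binary symbol $\mathsf{U}$; GFU formulas are the equality-free (except trivial guards $x=x$) guarded formulas, and a structure is admissible ($\mathsf{U}$-biquitous) iff it interprets $\mathsf{U}$ as the full relation $A\times A$. *)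

(* Defs.v *)
From mathcomp Require Import all_boot all_algebra.

Set Implicit Arguments.
Unset Strict Implicit.
Unset Printing Implicit Defensive.

Record signature := Signature {
  rel_sym : Type;
  cst_sym : Type;
  arity : rel_sym -> nat;
  arity_gt0 : forall r : rel_sym, 0 < arity r
}.

Section Syntax.

Variable S : signature.

Inductive term := Var of nat | Cst of cst_sym S.

Inductive formula :=
  | Rel (r : rel_sym S) of (arity r).-tuple term
  | Eq of term & term
  | Not of formula
  | And of formula & formula
  | Or of formula & formula
  | Imp of formula & formula
  | Iff of formula & formula
  | All of nat & formula
  | Ex of nat & formula.

Definition fv_term (t : term) : seq nat := if t is Var x then [:: x] else [::].

Fixpoint fv (f : formula) : seq nat :=
  match f with
  | Rel _ ts => flatten (map fv_term ts)
  | Eq t u => fv_term t ++ fv_term u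
  | Not g => fv g
  | And g h | Or g h | Imp g h | Iff g h => fv g ++ fv h
  | All x g | Ex x g => [seq y <- fv g | y != x]
  end.

Definition sentence (f : formula) : Prop := fv f = [::].

(* Every occurrence of a variable, constant, relation symbol, connective,
   quantifier or equality sign counts 1, and parentheses and commas count 0.
   This is at most the length of f written as a word over a finite alphabet,
   so bounds that are monotone in the length are strongest for this measure. *)
Fixpoint flen (f : formula) : nat :=
  match f with
  | Rel r _ => (arity r).+1
  | Eq _ _ => 3
  | Not g => (flen g).+1
  | And g h | Or g h | Imp g h | Iff g h => (flen g + flen h).+1
  | All _ g | Ex _ g => (flen g).+2
  end.

Definition all_block (xs : seq nat) (f : formula) : formula := foldr All f xs.
Definition ex_block (xs : seq nat) (f : formula) : formula := foldr Ex f xs.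

(* The guard x = x is available even when equality is not. *)
Inductive is_guard (eq : bool) : formula -> Prop :=
  | Guard_rel r ts : is_guard eq (@Rel r ts)
  | Guard_triv x : is_guard eq (Eq (Var x) (Var x))
  | Guard_eq t u : eq -> is_guard eq (Eq t u).

(* The flag eq allows arbitrary equality atoms; the flag tri allows unguarded
   quantification over formulas with at most two free variables.
   In G_all1 and G_ex1 the trivial guard y = y is left implicit. *)
Inductive guarded (eq tri : bool) : formula -> Prop :=
  | G_rel r ts : guarded eq tri (@Rel r ts)
  | G_eq t u : eq -> guarded eq tri (Eq t u)
  | G_not f : guarded eq tri f -> guarded eq tri (Not f)
  | G_and f g :
      guarded eq tri f -> guarded eq tri g -> guarded eq tri (And f g)
  | G_or f g :
      guarded eq tri f -> guarded eq tri g -> guarded eq tri (Or f g)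
  | G_imp f g :
      guarded eq tri f -> guarded eq tri g -> guarded eq tri (Imp f g)
  | G_iff f g :
      guarded eq tri f -> guarded eq tri g -> guarded eq tri (Iff f g)
  | G_all xs guard f :
      xs != [::] -> is_guard eq guard -> {subset fv f <= fv guard} ->
      guarded eq tri f -> guarded eq tri (all_block xs (Imp guard f))
  | G_ex xs guard f :
      xs != [::] -> is_guard eq guard -> {subset fv f <= fv guard} ->
      guarded eq tri f -> guarded eq tri (ex_block xs (And guard f))
  | G_all1 x y f :
      {subset fv f <= [:: y]} ->
      guarded eq tri f -> guarded eq tri (All x f)
  | G_ex1 x y f :
      {subset fv f <= [:: y]} ->
      guarded eq tri f -> guarded eq tri (Ex x f)
  | G_all2 x y f :
      tri -> {subset fv f <= [:: x; y]} ->
      guarded eq tri f -> guarded eq tri (All x f)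
  | G_ex2 x y f :
      tri -> {subset fv f <= [:: x; y]} ->
      guarded eq tri f -> guarded eq tri (Ex x f).

Definition GF : formula -> Prop := guarded true false.
Definition GF_eqfree : formula -> Prop := guarded false false.
Definition TGF : formula -> Prop := guarded false true.

End Syntax.

Section Semantics.

Variable S : signature.

Record structure (A : Type) := Structure {
  domain_inhabited : inhabited A;
  rel_interp : forall r : rel_sym S, (arity r).-tuple A -> Prop;
  cst_interp : cst_sym S -> A
}.

Variables (A : Type) (M : structure A).

Definition term_val (v : nat -> A) (t : term S) : A :=
  match t with Var x => v x | Cst c => cst_interp M c end.

Definition update (v : nat -> A) (x : nat) (a : A) : nat -> A :=
  fun y => if y == x then a else v y.

Fixpoint holds (v : nat -> A) (f : formula S) : Prop :=
  match f with
  | Rel r ts => rel_interp M (map_tuple (term_val v) ts)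
  | Eq t u => term_val v t = term_val v u
  | Not g => ~ holds v g
  | And g h => holds v g /\ holds v h
  | Or g h => holds v g \/ holds v h
  | Imp g h => holds v g -> holds v h
  | Iff g h => holds v g <-> holds v h
  | All x g => forall a : A, holds (update v x a) g
  | Ex x g => exists a : A, holds (update v x a) g
  end.

Definition models (f : formula S) : Prop := forall v : nat -> A, holds v f.

End Semantics.

Definition satisfiable (S : signature) (f : formula S) : Prop :=
  exists (A : Type) (M : structure S A), models M f.

Record Usignature := USignature {
  base_sig :> signature;
  U_sym : rel_sym base_sig;
  U_binary : arity U_sym = 2
}.

Definition GFU (S : Usignature) : formula S -> Prop := @GF_eqfree S.

(* Quantifying over (arity U_sym).-tuple A, which is 2.-tuple A by U_binary,
   says that U is interpreted as A * A without a cast along U_binary. *)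
Definition U_biquitous (S : Usignature) (A : Type) (M : structure S A) : Prop :=
  forall t : (arity (U_sym S)).-tuple A, rel_interp M t.

(* Main.v *)
Require Import Defs.
From mathcomp Require Import all_boot all_algebra boolp zify.

(* A random construction in the manner of Gurevich and Shelah's treatment of
   the Goedel class. Let A be a model of f. Every subset s of a large finite set
   D receives at random a map prop s : D -> A, up to the type it induces on s,
   that is, the truth in A of the subformulas of f at points of s and constants.
   Call s live if the types given to its subsets are the restrictions of its
   own, and let an atom hold at a tuple of D when the set of its entries is live
   and the atom holds at the image in A. A guard can only be true on a live set,
   and sets of at most two points are made live by fiat, so by induction on
   guarded subformulas truth at points of a live set s is truth in A at the
   image of s. The existential steps need witnesses: a live set u with fewer
   points than f has symbols must have, for each one-point extension of its type
   in A, a point b of D such that u + b is live with that type. For given b the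
   sets t + b with t a subset of u carry the right types with probability q > 0
   independent of D, and these events are independent for distinct b, so all
   witnesses exist with positive probability once D is large compared with 1/q.
   There are doubly exponentially many types, which gives the bound. *)

Set Implicit Arguments.
Unset Strict Implicit.
Unset Printing Implicit Defensive.

(** * Generic colourings of finite sets *)

(** Independence in counting form: as [c] is injective the blocks [c (j, _)] are disjoint, and on
    each block [w] has to avoid just one of [#|Omega| ^ #|T|] functions. *)
Lemma card_avoiding_blocks (I J T Omega : finType) (o : Omega)
    (c : J * T -> I) (g : J -> T -> Omega) :
  injective c ->
  #|[set w : {ffun I -> Omega} |
       [forall j, exists t, w (c (j, t)) != g j t]]| *
    (#|Omega| ^ #|T|) ^ #|J| <=
  #|Omega| ^ #|I| * (#|Omega| ^ #|T|).-1 ^ #|J|.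
Proof.
move=> c_inj.
set bad := [set w | _].
(* The second component is reset to [o] on the blocks, so that it ranges over one function for each
   choice of values off the blocks. *)
pose split_w (w : {ffun I -> Omega}) :=
  ([ffun j => [ffun t => w (c (j, t))]],
   [ffun i => if i \in codom c then o else w i]).
have split_inj : injective split_w.
  move=> w w' [/ffunP eq_in /ffunP eq_out]; apply/ffunP=> i.
  have [/codomP[[j t] ->]|niI] := boolP (i \in codom c).
    by have := eq_in j; rewrite !ffunE => /ffunP/(_ t); rewrite !ffunE.
  by have := eq_out i; rewrite !ffunE (negbTE niI).
pose F (j : J) := predC1 [ffun t => g j t].
pose Out := pffun_on o [predC codom c] predT.
have sub_bad : {subset split_w @: bad <= setX [set x in family F] [set x in Out]}.
  move=> z /imsetP[w]; rewrite inE => /forallP badw ->.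
  rewrite in_setX !inE /=; apply/andP; split.
    apply/forallP=> j; rewrite inE; have /existsP[t] := badw j.
    by rewrite ffunE; apply: contraNneq => /ffunP/(_ t); rewrite !ffunE => ->.
  by apply/forallP=> i; rewrite ffunE inE; case: ifP => //= _; rewrite inE.
have := subset_leq_card (introT subsetP sub_bad).
rewrite card_imset // cardsX !cardsE card_family card_pffun_on.
have -> : foldr muln 1 [seq #|F x| | x : J] = (#|Omega| ^ #|T|).-1 ^ #|J|.
  rewrite foldrE big_map big_enum /= -[RHS]prod_nat_const.
  apply: eq_bigr => j _; rewrite -card_ffun.
  by rewrite cardC1.
have -> : #|[predC codom c]| = #|I| - #|J| * #|T|.
  have := cardC [in codom c]; rewrite [X in X + _](card_codom c_inj) card_prod.
  by move=> <-; rewrite addKn.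
have leJT : #|J| * #|T| <= #|I| by rewrite -card_prod; apply: leq_card c_inj.
move/(leq_mul (leqnn ((#|Omega| ^ #|T|) ^ #|J|))).
rewrite mulnC => /leq_trans-> //.
rewrite mulnCA -!expnM (mulnC #|T|) [X in _ * X <= _]mulnC -expnD [X in X <= _]mulnC.
by rewrite (_ : #|{: Omega}| = #|Omega|) // subnK.
Qed.

(** The block of [b] consists of the sets [b |: t] with [t] inside [u]. Since [b] is the only point
    of [b |: t] outside [u], both [b] and [t] can be recovered. *)
Lemma card_avoiding (D Omega : finType) (o : Omega) (u : {set D})
    (g : D -> {set D} -> Omega) :
  #|[set w : {ffun {set D} -> Omega} | [forall (b | b \notin u),
       exists t : {set D}, (t \subset u) && (w (b |: t) != g b t)]]| *
    (#|Omega| ^ (2 ^ #|u|)) ^ (#|D| - #|u|) <=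
  #|Omega| ^ #|{set D}| * (#|Omega| ^ (2 ^ #|u|)).-1 ^ (#|D| - #|u|).
Proof.
pose J : finType := {b : D | b \notin u}.
pose T : finType := {t : {set D} | t \subset u}.
pose c (x : J * T) := val x.1 |: val x.2.
have c_inj : injective c.
  move=> [[b nbu] [t tu]] [[b' nbu'] [t' tu']] /= /setP eqc.
  have memu x : x \in u -> (x \in t) = (x \in t').
    move=> xu; have := eqc x; rewrite !inE /=.
    have /negbTE-> : x != b by apply: contraTneq xu => ->.
    by have /negbTE-> : x != b' by apply: contraTneq xu => ->.
  have eqt : t = t'.
    apply/setP=> x; have [/memu //|nxu] := boolP (x \in u).
    by rewrite !(negbTE (contra (subsetP _ x) nxu)).
  have eqb : b = b'.
    have := eqc b; rewrite !inE /= eqxx /=.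
    by case: eqP => //= _ /esym/(subsetP tu'); rewrite (negbTE nbu).
  by congr (_, _); apply: val_inj.
have := card_avoiding_blocks o (fun j t => g (val j) (val t)) c_inj.
have -> : #|T| = 2 ^ #|u|.
  by rewrite card_sig -card_powerset; apply: eq_card => t; rewrite !inE.
have -> : #|J| = #|D| - #|u|.
  rewrite card_sig -(cardsC u) addKn -[RHS]cardsE; apply: eq_card => b.
  by rewrite !inE.
apply: leq_trans; rewrite leq_mul2r subset_leq_card ?orbT //.
apply/subsetP=> w; rewrite !inE => /forall_inP bad; apply/forallP=> -[b nbu].
have /existsP[t /andP[tu ne]] := bad b nbu.
by apply/existsP; exists (exist _ t tu).
Qed.

(** Monotonicity of [1 - 1 / x], cross-multiplied to stay in [nat]. *)
Lemma pred_ratio_homo x y : 0 < x -> x <= y -> x.-1 * y <= y.-1 * x.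
Proof. by case: x => // x _; case: y => // y le_xy /=; nia. Qed.

(* The union bound over P: for a fixed p the events indexed by b \notin u p are
   independent, each of probability 1 / #|Omega| ^ 2 ^ #|u p| for a random w. *)
Lemma generic_colouring (D P Omega : finType) (o : Omega) (k : nat)
    (u : P -> {set D}) (g : P -> D -> {set D} -> Omega) :
  let M := #|Omega| ^ (2 ^ k) in
  (forall p, #|u p| <= k) -> k <= #|D| ->
  #|P| * M.-1 ^ (#|D| - k) < M ^ (#|D| - k) ->
  exists w : {ffun {set D} -> Omega}, forall p, exists2 b, b \notin u p &
    forall t : {set D}, t \subset u p -> w (b |: t) = g p b t.
Proof.
move=> M ule leD ltP.
have m_gt0 : 0 < #|Omega| by apply/card_gt0P; exists o.
have M_gt0 : 0 < M by rewrite expn_gt0 m_gt0.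
pose bad p := [set w : {ffun {set D} -> Omega} | [forall (b | b \notin u p),
       exists t : {set D}, (t \subset u p) && (w (b |: t) != g p b t)]].
have bad_le p : #|bad p| * M ^ (#|D| - k) <=
    #|Omega| ^ #|{set D}| * M.-1 ^ (#|D| - k).
  have := card_avoiding o (u p) (g p); rewrite -/(bad p).
  set Mu := #|Omega| ^ _; set a := #|D| - k => le_bad.
  have Mu_gt0 : 0 < Mu by rewrite expn_gt0 m_gt0.
  have leMu : Mu <= M by rewrite leq_pexp2l // leq_pexp2l.
  have eqJ : #|D| - #|u p| = a + (k - #|u p|).
    by have := ule p; rewrite /a; lia.
  move: le_bad; rewrite eqJ; set d := k - _ => le_bad.
  (* A set with fewer than [k] points has [d] more candidates [b] and a better chance at each, so it
     fails no more often than the bound for [k] points allows. *)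
  have le_pow : Mu.-1 ^ (a + d) * M ^ a <= M.-1 ^ a * Mu ^ (a + d).
    rewrite !expnD mulnAC mulnA -!expnMn leq_mul //.
      case: (a) => // a'; rewrite leq_exp2r //.
      exact: pred_ratio_homo.
    by case: (d) => // d'; rewrite leq_exp2r // leq_pred.
  have : 0 < Mu ^ (a + d) by rewrite expn_gt0 Mu_gt0.
  move/(@leq_pmul2r _ _ _)<-.
  rewrite mulnAC; apply: leq_trans (leq_mul le_bad (leqnn (M ^ a))) _.
  by rewrite -!mulnA leq_mul2l le_pow orbT.
have : #|\bigcup_p bad p| < #|{ffun {set D} -> Omega}|.
  have le_cup : #|\bigcup_p bad p| <= \sum_p #|bad p|.
    elim/big_rec2: _ => [|p n A _ leA]; first by rewrite cards0.
    by rewrite (leq_trans (leq_card_setU _ _)) // leq_add2l.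
  rewrite card_ffun (leq_ltn_trans le_cup) //.
  have Ma_gt0 : 0 < M ^ (#|D| - k) by rewrite expn_gt0 M_gt0.
  rewrite -(@ltn_pmul2r _ _ _ Ma_gt0) big_distrl /=.
  apply: (@leq_ltn_trans
    (\sum_(p : P) #|Omega| ^ #|{set D}| * M.-1 ^ (#|D| - k))).
    by apply: leq_sum => p _; apply: bad_le.
  rewrite sum_nat_const mulnCA ltn_pmul2l ?expn_gt0 ?m_gt0 //.
move=> lt_cup.
have /existsP[w nbad] : [exists w, w \notin \bigcup_p bad p].
  apply: contraTT lt_cup; rewrite negb_exists -leqNgt => /forallP all_in.
  rewrite -cardsT subset_leq_card //; apply/subsetP=> w _.
  by have := all_in w; rewrite negbK.
exists w => p; have : w \notin bad p.
  by apply: contra nbad => wp; apply/bigcupP; exists p.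
rewrite inE negb_forall => /existsP[b]; rewrite negb_imply => /andP[nbu].
rewrite negb_exists => /forallP eqg; exists b => // t tu.
by have := eqg t; rewrite tu /= negbK => /eqP.
Qed.

(** * Arithmetic for the size of the domain *)

Lemma expn_pred_halving M : 0 < M -> 2 * M.-1 ^ M <= M ^ M.
Proof.
case: M => // -[|n] _ //=.
(* Bernoulli's inequality for [(1 + 1 / n.+1) ^ m], applied below with [m = n.+2 = M]. *)
have bern m : n.+1 ^ m * (n.+1 + m) <= n.+1 * n.+2 ^ m.
  elim: m => [|m IH]; first by rewrite !expn0 addn0 mul1n muln1.
  by rewrite !expnS; nia.
by have := bern n.+2; rewrite [n.+1 ^ _]expnS [n.+1 ^ n.+1]expnS;
   move: (n.+1 ^ n) (n.+2 ^ n.+2) => a b; nia.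
Qed.

Lemma expn_pred_decay M j : 0 < M -> 2 ^ j * M.-1 ^ (M * j) <= M ^ (M * j).
Proof.
move=> M0; rewrite !expnM -expnMn; case: j => // j.
by rewrite leq_exp2r // expn_pred_halving.
Qed.

(* N - n is a multiple M * j of M, so that (1 - 1 / M) ^ (N - n) <= 2 ^ - j, and
   j = 2 ^ c with c large enough to beat N.+1 ^ n * 2 ^ e0. *)
Lemma colouring_size (n e0 e M N : nat) :
  e = e0 * 2 ^ n -> M = 2 ^ e -> N = n + M * 2 ^ (4 * (e + n) + 4) ->
  N.+1 ^ n * 2 ^ e0 * M.-1 ^ (N - n) < M ^ (N - n).
Proof.
move=> eE ME NE; rewrite {2 3}NE addKn.
have M_gt0 : 0 < M by rewrite ME expn_gt0.
set c := 4 * _ + 4; set x := e + n.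
have N_le : N.+1 <= 2 ^ (x + c + 1).
  have h1 : n < 2 ^ n by apply: ltn_expl.
  have : 2 ^ (x + c + 1) = 2 ^ n * (M * 2 ^ c) * 2.
    by rewrite ME -!expnD -expnSr; f_equal; rewrite /x; lia.
  have : 0 < M * 2 ^ c by rewrite muln_gt0 M_gt0 expn_gt0.
  by rewrite NE -/c; move: (M * 2 ^ c) (2 ^ n) h1 => a b; nia.
have e0_le : e0 <= x.
  have pos : 0 < 2 ^ n by rewrite expn_gt0.
  by rewrite /x eE; move: (2 ^ n) pos => a pos; nia.
have lt_c : (x + c + 1) * n + e0 < 2 ^ c.
  have hx : x < 2 ^ x by apply: ltn_expl.
  have -> : 2 ^ c = 16 * (2 ^ x) ^ 4.
    by rewrite -expnM /c -/x expnD mulnC [x * 4]mulnC.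
  have n_le : n <= x by rewrite /x leq_addl.
  have -> : x + c + 1 = 5 * x + 5 by rewrite /c -/x; lia.
  move: (2 ^ x) hx => y hx.
  have y_gt0 : 0 < y by apply: leq_ltn_trans hx.
  have h1 : (5 * x + 5) * n <= 5 * y * y by apply: leq_mul; lia.
  have h2 : y <= y * y by rewrite leq_pmulr.
  have -> : y ^ 4 = y * y * (y * y) by rewrite !expnS expn0 !mulnA muln1.
  have : y * y <= y * y * (y * y) by rewrite leq_pmulr // muln_gt0 y_gt0.
  rewrite -mulnA in h1.
  by move: h1 h2 y_gt0; move: (y * y) => z; move: (z * z) (_ * n) => *; lia.
have P_lt : N.+1 ^ n * 2 ^ e0 < 2 ^ (2 ^ c).
  apply: (@leq_ltn_trans (2 ^ ((x + c + 1) * n + e0))); last first.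
    by rewrite ltn_exp2l.
  rewrite expnD leq_mul2r expnM; apply/orP; right.
  by case: (n) => // n'; rewrite leq_exp2r.
(* For [M = 1] this power is zero and cannot be cancelled. *)
have [->|pos] := posnP (M.-1 ^ (M * 2 ^ c)).
  by rewrite muln0 expn_gt0 M_gt0.
apply: leq_trans (expn_pred_decay (2 ^ c) M_gt0).
by rewrite ltn_pmul2r.
Qed.

(** * Subformulas, free variables and quantifier blocks *)

Section Formulas.

Variable S : signature.
Implicit Types (f g : formula S) (A : Type).

Fixpoint subs f : seq (formula S) :=
  f :: match f with
  | Not g | All _ g | Ex _ g => subs g
  | And g h | Or g h | Imp g h | Iff g h => (subs g ++ subs h)%list
  | _ => [::]
  end.

Definition cst_term (t : term S) : seq (cst_sym S) :=
  if t is Cst c then [:: c] else [::].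

Fixpoint csts f : seq (cst_sym S) :=
  match f with
  | Rel _ ts => flatten (map cst_term ts)
  | Eq t u => cst_term t ++ cst_term u
  | Not g | All _ g | Ex _ g => csts g
  | And g h | Or g h | Imp g h | Iff g h => csts g ++ csts h
  end.

Lemma size_subs f : size (subs f) <= flen f.
Proof.
have size_app g h : size (subs g ++ subs h)%list = size (subs g) + size (subs h).
  exact: size_cat.
by elim: f => //= *; rewrite ?size_app; lia.
Qed.

Lemma size_flatten_tuple (T U : Type) n (F : T -> seq U) (ts : n.-tuple T) :
  (forall t, size (F t) <= 1) -> size (flatten (map F ts)) <= n.
Proof.
move=> leF; rewrite -[X in _ <= X](size_tuple ts).
by elim: (tval ts) => //= t s IH; rewrite size_cat; have := leF t; lia.
Qed.

Lemma size_csts f : size (csts f) <= flen f.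
Proof.
have le1 t : size (cst_term t) <= 1 by case: t.
elim: f => //= [r ts|t u|*|*|*|*|*|*|*]; rewrite ?size_cat; try lia.
- by rewrite leqW // size_flatten_tuple.
- by have := le1 t; have := le1 u; lia.
Qed.

Lemma size_fv f : size (fv f) <= flen f.
Proof.
have le1 (t : term S) : size (fv_term t) <= 1 by case: t.
elim: f => //= [r ts|t u|*|*|*|*|*|n g IH|n g IH]; rewrite ?size_cat; try lia.
- by rewrite leqW // size_flatten_tuple.
- by have := le1 t; have := le1 u; lia.
- by rewrite size_filter (leq_trans (count_size _ _)) // ltnW // ltnW.
- by rewrite size_filter (leq_trans (count_size _ _)) // ltnW // ltnW.
Qed.

Lemma subs_refl f : List.In f (subs f).
Proof. by case: f => *; left. Qed.

Lemma flen_subs f g : List.In g (subs f) -> flen g <= flen f.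
Proof.
elim: f => /= [r ts|t u|f IH|f IHf h IHh|f IHf h IHh|f IHf h IHh|f IHf h IHh
  |n f IH|n f IH] [<-//|] //; try by move=> /IH; lia.
all: by move=> H; case: (List.in_app_or _ _ _ H) => [/IHf|/IHh]; lia.
Qed.

Lemma holds_fv A (M : structure S A) f v v' :
  {in fv f, v =1 v'} -> holds M v f <-> holds M v' f.
Proof.
have term_fv (t : term S) (w w' : nat -> A) :
  {in fv_term t, w =1 w'} -> term_val M w t = term_val M w' t.
  by case: t => //= x; apply; rewrite inE.
have catE (s1 s2 : seq nat) (w w' : nat -> A) : {in s1 ++ s2, w =1 w'} ->
    {in s1, w =1 w'} /\ {in s2, w =1 w'}.
  by move=> eqw; split=> x xs; apply: eqw; rewrite mem_cat xs ?orbT.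
have updE g x (w w' : nat -> A) a : {in [seq y <- fv g | y != x], w =1 w'} ->
    {in fv g, update w x a =1 update w' x a}.
  move=> eqw y yg; rewrite /update; case: eqP => // /eqP ne.
  by apply: eqw; rewrite mem_filter ne.
elim: f v v' => /= [r ts|t u|f IH|f IHf h IHh|f IHf h IHh|f IHf h IHh
  |f IHf h IHh|n f IH|n f IH] v v' eqv.
- suff -> : map_tuple (term_val M v) ts = map_tuple (term_val M v') ts by [].
  apply: val_inj => /=; elim: (tval ts) eqv => //= t s IHs /catE[eqt eqs].
  by rewrite (term_fv _ _ _ eqt) IHs.
- have [eqt equ] := catE _ _ _ _ eqv.
  by rewrite (term_fv _ _ _ eqt) (term_fv _ _ _ equ).
- by have := IH _ _ eqv; tauto.
- by have [/IHf + /IHh] := catE _ _ _ _ eqv; tauto.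
- by have [/IHf + /IHh] := catE _ _ _ _ eqv; tauto.
- by have [/IHf + /IHh] := catE _ _ _ _ eqv; tauto.
- by have [/IHf + /IHh] := catE _ _ _ _ eqv; tauto.
- by split=> H a; apply/(IH _ _ (updE _ _ _ _ a eqv)).
- by split=> -[a H]; exists a; apply/(IH _ _ (updE _ _ _ _ a eqv)).
Qed.

Lemma fv_all_block xs f y : (y \in fv (all_block xs f)) = (y \notin xs) && (y \in fv f).
Proof.
by elim: xs => //= x xs IH; rewrite mem_filter IH inE negb_or andbA.
Qed.

Lemma fv_ex_block xs f y : (y \in fv (ex_block xs f)) = (y \notin xs) && (y \in fv f).
Proof.
by elim: xs => //= x xs IH; rewrite mem_filter IH inE negb_or andbA.
Qed.

Lemma holds_ex_block A (M : structure S A) xs f v :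
  holds M v (ex_block xs f) <->
  exists2 v', (forall y, y \notin xs -> v' y = v y) & holds M v' f.
Proof.
elim: xs v => /= [|x xs IH] v.
  split=> [H|[v' eqv]]; first by exists v.
  by rewrite (_ : v' = v) //; apply: funext => y; apply: eqv.
split=> [[a /IH[v' eqv H]]|[v' eqv H]].
  exists v' => // y; rewrite inE negb_or => /andP[/negbTE ne nxs].
  by rewrite eqv // /update ne.
exists (v' x); apply/IH; exists v' => // y nxs; rewrite /update.
by case: eqP => [->//|/eqP ne]; apply: eqv; rewrite inE negb_or ne.
Qed.

Lemma holds_all_block A (M : structure S A) xs f v :
  holds M v (all_block xs f) <->
  forall v', (forall y, y \notin xs -> v' y = v y) -> holds M v' f.
Proof.
elim: xs v => /= [|x xs IH] v.
  split=> [H v' eqv|]; last by apply.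
  by rewrite (_ : v' = v) //; apply: funext => y; apply: eqv.
split=> [H v' eqv|H a].
  have /IH := H (v' x); apply=> y nxs; rewrite /update.
  by case: eqP => [->//|/eqP ne]; apply: eqv; rewrite inE negb_or ne.
apply/IH => v' eqv; apply: H => y; rewrite inE negb_or => /andP[/negbTE ne nxs].
by rewrite eqv // /update ne.
Qed.

End Formulas.

(** * The model patched from types *)

Lemma In_tnth T (s : seq T) x :
  List.In x s -> exists i : 'I_(size s), tnth (in_tuple s) i = x.
Proof.
move=> xs; suff [i lti eqx] : exists2 i, i < size s & nth x s i = x.
  by exists (Ordinal lti); rewrite (tnth_nth x).
elim: s xs => //= y s IH [->|/IH[i lti eqx]]; first by exists 0.
by exists i.+1.
Qed.

(** * Types over finite sets and their finite coding *)

Section Types.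

Variables (S : signature) (A : Type) (M : structure S A).
Variables (cs : seq (cst_sym S)) (Phi : seq (formula S)).
Local Notation C := 'I_(size cs).

(* A structure over X + C has one element for each occurrence of a constant in
   cs, whether or not their values in M coincide: without equality this
   cannot be detected. *)
Definition ext (X : Type) (h : X -> A) (b : X + C) : A :=
  match b with
  | inl x => h x
  | inr i => cst_interp M (tnth (in_tuple cs) i)
  end.

Definition within (X : finType) (s : {set X}) (v : nat -> X + C) (f : formula S) :=
  forall x d, x \in fv f -> v x = inl d -> d \in s.

(** The maps [h] and [h'] realise the same type on [s]. Valuations may identify variables or send
    them to constants, so substitution instances of formulas in [Phi] are covered. *)
Definition eqv (X : finType) (s : {set X}) (h h' : X -> A) :=
  forall f, List.In f Phi -> forall v, within s v f ->
  (holds M (ext h \o v) f <-> holds M (ext h' \o v) f).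

Lemma within_sub (X : finType) (s t : {set X}) v f :
  s \subset t -> within s v f -> within t v f.
Proof. by move=> /subsetP st sv x d xf vx; apply: st; apply: sv vx. Qed.

Lemma eqv_sym (X : finType) (s : {set X}) h h' : eqv s h h' -> eqv s h' h.
Proof. by move=> E f fP v sv; split=> /(E f fP v sv). Qed.

Lemma eqv_trans (X : finType) (s : {set X}) h2 h1 h3 :
  eqv s h1 h2 -> eqv s h2 h3 -> eqv s h1 h3.
Proof.
by move=> E E' f fP v sv; split=> [/(E f fP v sv)/(E' f fP v sv)|
  /(E' f fP v sv)/(E f fP v sv)].
Qed.

Lemma eqv_sub (X : finType) (s t : {set X}) h h' :
  s \subset t -> eqv t h h' -> eqv s h h'.
Proof. by move=> st E f fP v sv; apply: E => //; apply: within_sub sv. Qed.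

Lemma holds_ext_agree (X : finType) (s : {set X}) h h' v f :
  {in s, h =1 h'} -> within s v f ->
  holds M (ext h \o v) f <-> holds M (ext h' \o v) f.
Proof.
move=> E sv; apply: holds_fv => x xf /=.
by case vx: (v x) => [d|//] /=; apply: E; apply: sv vx.
Qed.

Lemma eqv_agree (X : finType) (s : {set X}) h h' :
  {in s, h =1 h'} -> eqv s h h'.
Proof. by move=> E f _ v; apply: holds_ext_agree. Qed.

(** A valuation in [X] is pushed along [rho] to one in [Y] with the same values in [A]. This lets
    points of [D] be renamed by their ranks. *)
Lemma eqv_comp (X Y : finType) (rho : X -> Y) (s : {set X}) (a a' : Y -> A) :
  eqv [set: Y] a a' -> eqv s (a \o rho) (a' \o rho).
Proof.
move=> E f fP v _.
pose w x : Y + C := match v x with inl d => inl (rho d) | inr i => inr i end.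
have extE (b : Y -> A) : ext (b \o rho) \o v = ext b \o w.
  by apply: funext => x; rewrite /= /w; case: (v x).
by rewrite !extE; apply: E.
Qed.

(** Only values at free variables matter, so a type is a truth table over assignments to boundedly
    many positions; [rep] chooses a realisation of each table. *)
Lemma finite_types (Y : finType) (L : nat) (a0 : A)
    (Omega := {ffun 'I_(size Phi) * {ffun 'I_L.+1 -> Y + C} -> bool}) :
  (forall f, List.In f Phi -> size (fv f) <= L) ->
  exists (tp : (Y -> A) -> Omega) (rep : Omega -> Y -> A),
    forall a, eqv [set: Y] a (rep (tp a)).
Proof.
move=> leL.
(* A variable is looked up at its first position in [fv f]; the successor in ['I_L.+1] keeps the
   index type inhabited, as [inord] requires. *)
pose val (f : formula S) (w : {ffun 'I_L.+1 -> Y + C}) (x : nat) : Y + C :=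
  w (inord (index x (fv f))).
pose tp (a : Y -> A) : Omega := [ffun q =>
  let f := tnth (in_tuple Phi) q.1 in `[< holds M (ext a \o val f q.2) f >]].
have [rep repP] : {rep : Omega -> Y -> A &
    forall o a, tp a = o -> tp (rep o) = o}.
  apply: (@choice _ _ (fun o b => forall a, tp a = o -> tp b = o)) => o.
  have [[a aP]|no] := pselect (exists a, tp a = o); first by exists a.
  by exists (fun=> a0) => a aP; case: no; exists a.
exists tp, rep => a f fP v _.
have [i fE] := In_tnth fP.
pose w : {ffun 'I_L.+1 -> Y + C} := [ffun j : 'I__ => v (nth 0 (fv f) j)].
have valE b : holds M (ext b \o v) f <-> holds M (ext b \o val f w) f.
  apply: holds_fv => x xf /=; rewrite /val ffunE inordK ?nth_index //.
  by rewrite ltnS ltnW // (leq_trans _ (leL f fP)) ?index_mem.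
have tpE b : holds M (ext b \o v) f <-> tp b (i, w).
  by rewrite ffunE /= fE; split=> [/valE/asboolP|/asboolP/valE].
by split=> /tpE H; apply/tpE; move: H; rewrite (repP _ a erefl).
Qed.

End Types.

(** * Charts, live sets and their one-point extensions *)

Section Model.

Variables (S : signature) (A : Type) (M : structure S A).
Variables (cs : seq (cst_sym S)) (Phi : seq (formula S)).
Variables (D : finType) (prop : {set D} -> D -> A).
Local Notation C := 'I_(size cs).
Local Notation B := (D + C)%type.
Local Notation eqv := (eqv M cs Phi).
Local Notation ext := (@ext S A M cs _).

Definition coherent (s : {set D}) :=
  forall x, x \in s -> eqv [set x] (prop s) (prop [set x]).

(* In the fallback case chart s still agrees with prop at each point of s, so
   that every set of at most two points is live (live_small); this is what
   unguarded quantification over pairs and the universality of U rely on. *)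
Definition chart (s : {set D}) : D -> A :=
  if `[< coherent s >] then prop s else fun x => prop [set x] x.

Definition live (s : {set D}) := forall r : {set D}, r \subset s -> eqv r (chart r) (chart s).

(** Coherence gives this in the first branch of [chart], and the fallback is built for it; hence
    charts never clash at single points. *)
Lemma chart_point (s : {set D}) x : x \in s -> eqv [set x] (chart s) (prop [set x]).
Proof.
move=> xs; rewrite /chart; case: asboolP => [/(_ x xs)//|_].
by apply: eqv_agree => y /set1P->.
Qed.

(** A proper subset has at most one point, where [chart_point] fixes the type. *)
Lemma live_small (s : {set D}) : #|s| <= 2 -> live s.
Proof.
move=> s2 r rs; have [-> |nrs] := eqVneq r s; first exact: eqv_agree.
have : #|r| <= 1.
  have : r \proper s by rewrite properEneq nrs.
  by move/proper_card; lia.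
rewrite leq_eqVlt ltnS leqn0 cards_eq0 => /orP[/cards1P[x rE]|/eqP->].
  rewrite rE; apply: (eqv_trans (chart_point (set11 x))); apply: eqv_sym.
  by apply: chart_point; apply: (subsetP rs); rewrite rE set11.
by apply: eqv_agree => x; rewrite inE.
Qed.

Lemma live_sub (r s : {set D}) : r \subset s -> live s -> live r.
Proof.
move=> rs sl t tr; apply: (eqv_trans (sl t (subset_trans tr rs))).
by apply: eqv_sym; apply: eqv_sub tr (sl r rs).
Qed.

(** Each [b |: t] is coherent: the type of [b] is compared through [t = set0], that of a point of
    [u] through [chart u]. So its chart is [prop], of type [H]. A subset of [b |: u] is either such
    a set or a subset of the live set [u]. *)
Lemma live_extend (u : {set D}) b (H : D -> A) :
  live u -> b \notin u -> eqv u H (chart u) ->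
  (forall t : {set D}, t \subset u -> eqv (b |: t) (prop (b |: t)) H) ->
  live (b |: u) /\ eqv (b |: u) (chart (b |: u)) H.
Proof.
move=> ul nbu Hu propH.
have embH (t : {set D}) : t \subset u -> eqv (b |: t) (chart (b |: t)) H.
  move=> tu; suff coh : coherent (b |: t).
    by rewrite /chart; case: asboolP => // _; apply: propH.
  move=> x xbt; have /eqv_trans : eqv [set x] (prop (b |: t)) H.
    by apply: eqv_sub (propH t tu); rewrite sub1set.
  apply; case/setU1P: xbt => [->|xt].
    by have := propH set0 (sub0set _); rewrite setU0; apply: eqv_sym.
  have xu : [set x] \subset u by rewrite sub1set (subsetP tu).
  apply: (eqv_trans (eqv_sub xu Hu)).
  by apply: chart_point; rewrite (subsetP tu).
split; last exact: embH.
move=> r rbu; have /eqv_sym Hbu := eqv_sub rbu (embH u (subxx u)).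
apply: eqv_trans Hbu.
have [br|nbr] := boolP (b \in r).
  by have := embH (r :\ b); rewrite setD1K //; apply; rewrite subDset.
have ru : r \subset u.
  apply/subsetP=> x xr; have /setU1P[xb|//] := subsetP rbu x xr.
  by rewrite xb (negbTE nbr) in xr.
by apply: (eqv_trans (ul r ru)); apply/eqv_sym/(eqv_sub ru).
Qed.

(** * The patched structure and its atoms *)

Variables (d0 : D) (cB : cst_sym S -> B).
Hypothesis cBP : forall c, List.In c cs ->
  exists2 i, cB c = inr i & tnth (in_tuple cs) i = c.

Definition tsupp n (tb : n.-tuple B) : {set D} := [set d | inl d \in tb].

Definition patched : structure S B := Structure
  (inhabits (inl d0))
  (fun r tb => live (tsupp tb) /\
               rel_interp M (map_tuple (ext (chart (tsupp tb))) tb))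
  cB.

Definition scoped (f : formula S) :=
  (forall g, List.In g (subs f) -> List.In g Phi) /\
  (forall c, List.In c (csts f) -> List.In c cs).

Definition preserved (f : formula S) := forall s v, live s -> within s v f ->
  (holds patched v f <-> holds M (ext (chart s) \o v) f).

Lemma In_cat T (x : T) s t : List.In x (s ++ t) <-> List.In x s \/ List.In x t.
Proof. exact: List.in_app_iff. Qed.

Lemma tsupp_fv r ts v d : (forall c, List.In c (csts (@Rel S r ts)) -> List.In c cs) ->
  d \in tsupp (map_tuple (term_val patched v) ts) <->
  exists2 x, x \in fv (Rel ts) & v x = inl d.
Proof.
rewrite inE -[_ \in map_tuple _ _]/(inl d \in map (term_val patched v) ts) /=.
elim: (tval ts) => /= [_|t s IH inC]; first by split=> // -[x].
rewrite inE; have {}IH := IH (fun c H => inC c (proj2 (In_cat _ _ _) (or_intror H))).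
have inCt c : List.In c (cst_term t) -> List.In c cs.
  by move=> H; apply: inC; apply/In_cat; left.
split=> [/orP[/eqP|/IH[x xs vx]]|[x]].
- case: t inCt {inC} => [x|c] /= inCt eqd.
    by exists x; rewrite ?mem_cat ?inE ?eqxx.
  by have [i cE _] := cBP (inCt c (or_introl erefl)); move: eqd; rewrite /= cE.
- by exists x; rewrite // mem_cat xs orbT.
- rewrite mem_cat => /orP[|xs vx]; last by rewrite (proj2 IH) ?orbT //; exists x.
  by case: (t) => //= y; rewrite inE => /eqP-> ->; rewrite eqxx.
Qed.

Lemma ext_term r ts v h : (forall c, List.In c (csts (@Rel S r ts)) -> List.In c cs) ->
  map_tuple (ext h) (map_tuple (term_val patched v) ts) =
  map_tuple (term_val M (ext h \o v)) ts.
Proof.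
move=> /= inC; apply: val_inj => /=; elim: (tval ts) inC => //= t s IH inC.
rewrite (IH (fun c H => inC c (proj2 (In_cat _ _ _) (or_intror H)))).
congr (_ :: _); case: t inC => //= c inC.
by have [i -> /= ->] := cBP (inC c (or_introl erefl)).
Qed.

(** The support of the atom lies in [s], so it is live and its chart has there the type of
    [chart s]. *)
Lemma preserved_rel r ts : scoped (@Rel S r ts) -> preserved (Rel ts).
Proof.
move=> [inP inC] s v sl sv /=; rewrite (ext_term _ _ inC).
set u := tsupp _; have us : u \subset s.
  by apply/subsetP=> d /(tsupp_fv _ _ inC)[x xf vx]; apply: sv vx.
have uv : within u v (Rel ts).
  by move=> x d xf vx; apply/(tsupp_fv _ _ inC); exists x.
have E := sl u us (Rel ts) (inP _ (subs_refl _)) v uv.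
by split=> [[_ /E//]|/E ?]; split=> //; apply: live_sub us sl.
Qed.

Lemma rel_live r ts v : scoped (@Rel S r ts) -> holds patched v (Rel ts) ->
  exists2 s, live s & within s v (Rel ts).
Proof.
move=> [_ inC] /= [ul _]; exists (tsupp (map_tuple (term_val patched v) ts)) => //.
by move=> x d xf vx; apply/(tsupp_fv _ _ inC); exists x.
Qed.

Lemma two_variables_live (v : nat -> B) x y f : {subset fv f <= [:: x; y]} ->
  exists2 s, live s & within s v f.
Proof.
move=> fxy; pose one z := if v z is inl d then [set d] else set0.
exists (one x :|: one y).
  apply: live_small; rewrite (leq_trans (leq_card_setU _ _)) //.
  have one1 z : #|one z| <= 1 by rewrite /one; case: (v z) => *; rewrite ?cards1 ?cards0.
  by have := one1 x; have := one1 y; lia.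
by move=> z d /fxy; rewrite !inE => /orP[]/eqP-> vz; rewrite /one vz set11 ?orbT.
Qed.

(** * Quantifiers in the patched structure *)

Definition vsupp (v : nat -> B) (f : formula S) : {set D} :=
  [set d | inl d \in map v (fv f)].

Lemma within_vsupp v f : within (vsupp v f) v f.
Proof. by move=> x d xf vx; rewrite inE -vx map_f. Qed.

Lemma vsupp_within s v f : within s v f -> vsupp v f \subset s.
Proof.
by move=> sv; apply/subsetP=> d; rewrite inE => /mapP[x xf vx]; apply: sv (esym vx).
Qed.

Lemma card_vsupp v f : #|vsupp v f| <= size (fv f).
Proof.
rewrite -(size_map v) -(card_imset _ (@inl_inj D C)).
apply: leq_trans (card_size _); apply: subset_leq_card; apply/subsetP=> b.
by case/imsetP=> d; rewrite inE => dv ->.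
Qed.

(** The genericity of [prop], established in [extension_exists]. The bound on [#|u|] is the one that
    [vsupp] satisfies. *)
Hypothesis extension : forall (u : {set D}) c, live u ->
  (exists2 f, List.In f Phi & #|u| <= size (fv f)) ->
  exists2 b, b \notin u &
    live (b |: u) /\
    eqv (b |: u) (chart (b |: u)) (fun x => if x == b then c else chart u x).

(** A value [c] in [A] for the quantified variable is mirrored by a new point [b]. The live set [s]
    may be too large to extend, so it is first cut down to [vsupp v g]. *)
Lemma extend_valuation s v x f g c : fv g = [seq y <- fv f | y != x] ->
  List.In f Phi -> List.In g Phi -> live s -> within s v g ->
  exists b t, [/\ live t, within t (update v x (inl b)) f &
    holds M (ext (chart t) \o update v x (inl b)) f <->
    holds M (update (ext (chart (vsupp v g)) \o v) x c) f].
Proof.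
move=> fvE fP gP sl sv; set u := vsupp v g.
have us : u \subset s by apply: vsupp_within.
have [||b nbu [tl tE]] := @extension u c; first exact: live_sub us sl.
  by exists g => //; apply: card_vsupp.
have tv : within (b |: u) (update v x (inl b)) f.
  move=> y d yf; rewrite /update; case: eqP => [_ [->]|/eqP ne vy].
    by rewrite setU11.
  by rewrite in_setU1 (within_vsupp _ vy) ?orbT // fvE mem_filter ne.
exists b, (b |: u); split=> //.
apply: (iff_trans (tE f fP _ tv)); apply: holds_fv => y yf /=.
rewrite /update; case: eqP => [_|/eqP ne] /=; first by rewrite eqxx.
case vy: (v y) => [d|//] /=; case: eqP => // db.
by case/negP: nbu; rewrite -db (within_vsupp _ vy) // fvE mem_filter ne.
Qed.

Lemma transfer_vsupp s v f : List.In f Phi -> live s -> within s v f ->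
  holds M (ext (chart (vsupp v f)) \o v) f <-> holds M (ext (chart s) \o v) f.
Proof.
by move=> fP sl sv; apply: sl => //; [apply: vsupp_within|apply: within_vsupp].
Qed.

Lemma scoped_All x f : scoped (All x f) -> scoped f.
Proof. by case=> s c; split=> // g gf; apply: s; right. Qed.

Lemma scoped_Ex x f : scoped (Ex x f) -> scoped f.
Proof. by case=> s c; split=> // g gf; apply: s; right. Qed.

Lemma scoped_all_block xs f : scoped (all_block xs f) -> scoped f.
Proof. by elim: xs => //= x xs IH /scoped_All. Qed.

Lemma scoped_ex_block xs f : scoped (ex_block xs f) -> scoped f.
Proof. by elim: xs => //= x xs IH /scoped_Ex. Qed.

Lemma scoped_In f : scoped f -> List.In f Phi.
Proof. by case=> s _; apply/s/subs_refl. Qed.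

(** The tails of a guarded block are in general not guarded formulas, so the block is handled by
    induction on its variables, one witness at a time. *)
Lemma ex_block_reflected xs f : scoped (ex_block xs f) -> preserved f ->
  forall s v, live s -> within s v (ex_block xs f) ->
  holds M (ext (chart s) \o v) (ex_block xs f) -> holds patched v (ex_block xs f).
Proof.
move=> okf pf; elim: xs okf => [_ s v sl sv|x xs IH okf s v sl sv].
  by move/(pf s v sl sv).
move/(transfer_vsupp (scoped_In okf) sl sv) => /= -[c Hc].
have [b [t [tl tv E]]] :=
  @extend_valuation s v x _ (Ex x (ex_block xs f)) c erefl
    (scoped_In (scoped_Ex okf)) (scoped_In okf) sl sv.
exists (inl b); apply: (IH (scoped_Ex okf) t) => //.
by apply/E.
Qed.

(** Dually, an arbitrary [c] in [A] is mirrored by a point [b], at which the universal statement is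
    instantiated. *)
Lemma all_block_reflected xs f : scoped (all_block xs f) -> preserved f ->
  forall s v, live s -> within s v (all_block xs f) ->
  holds patched v (all_block xs f) -> holds M (ext (chart s) \o v) (all_block xs f).
Proof.
move=> okf pf; elim: xs okf => [_ s v sl sv|x xs IH okf s v sl sv H].
  by move/(pf s v sl sv).
apply/(transfer_vsupp (scoped_In okf) sl sv) => /= c.
have [b [t [tl tv E]]] :=
  @extend_valuation s v x _ (All x (all_block xs f)) c erefl
    (scoped_In (scoped_All okf)) (scoped_In okf) sl sv.
by apply/E; apply: (IH (scoped_All okf) t) => //.
Qed.

Lemma transfer s t v f : List.In f Phi -> live s -> live t ->
  within s v f -> within t v f ->
  holds M (ext (chart s) \o v) f <-> holds M (ext (chart t) \o v) f.
Proof.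
move=> fP sl tl sv tv; apply: iff_trans (transfer_vsupp fP tl tv).
by apply: iff_sym; apply: transfer_vsupp.
Qed.

(** A witness in the patched structure lies with the other values in a live set [t], over which [f]
    passes to [A]. The sets [s] and [t] need not be comparable, but they agree on the free variables
    of the block. *)
Lemma preserved_ex_block xs f : scoped (ex_block xs f) -> preserved f ->
  (forall v, holds patched v f -> exists2 s, live s & within s v f) ->
  preserved (ex_block xs f).
Proof.
move=> okf pf guard s v sl sv; split; last exact: ex_block_reflected.
case/holds_ex_block=> v' vE Hf; have [t tl tv] := guard v' Hf.
have tvx : within t v (ex_block xs f).
  by move=> y d; rewrite fv_ex_block => /andP[nyx yf]; rewrite -vE //; apply: tv.
apply/(transfer (scoped_In okf) sl tl sv tvx)/holds_ex_block.
exists (ext (chart t) \o v') => [y nyx /=|]; first by rewrite vE.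
by apply/(pf t v' tl tv).
Qed.

Lemma preserved_all_block xs f : scoped (all_block xs f) -> preserved f ->
  (forall v, ~ holds patched v f -> exists2 s, live s & within s v f) ->
  preserved (all_block xs f).
Proof.
move=> okf pf guard s v sl sv; split; first exact: all_block_reflected.
move=> H; apply/holds_all_block => v' vE; apply: contrapT => nHf.
have [t tl tv] := guard v' nHf; apply: nHf.
have tvx : within t v (all_block xs f).
  by move=> y d; rewrite fv_all_block => /andP[nyx yf]; rewrite -vE //; apply: tv.
apply/(pf t v' tl tv).
move/(transfer (scoped_In okf) sl tl sv tvx)/holds_all_block: H; apply=> y nyx /=.
by rewrite vE.
Qed.

Lemma guard_live g f v : is_guard false g -> scoped g -> {subset fv f <= fv g} ->
  holds patched v g -> exists2 s, live s & within s v f.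
Proof.
case=> [r ts|x|t u //] okg fg Hg.
  by have [s sl sv] := rel_live okg Hg; exists s => // x d /fg; apply: sv.
by apply: (@two_variables_live v x x) => y /fg.
Qed.

Lemma preserved_guard g : is_guard false g -> scoped g -> preserved g.
Proof. by case=> [r ts|x|//] okg; [apply: preserved_rel|]. Qed.

Lemma scoped_binary (op : formula S -> formula S -> formula S) f g :
  subs (op f g) = op f g :: (subs f ++ subs g)%list ->
  csts (op f g) = csts f ++ csts g -> scoped (op f g) -> scoped f /\ scoped g.
Proof.
rewrite /scoped => -> -> [s c]; split; split=> h H.
- by apply: s; right; apply/List.in_app_iff; left.
- by apply: c; apply/In_cat; left.
- by apply: s; right; apply/List.in_app_iff; right.
- by apply: c; apply/In_cat; right.
Qed.

Lemma within_cat (s : {set D}) (v : nat -> B) f g h : fv h = fv f ++ fv g -> within s v h ->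
  within s v f /\ within s v g.
Proof.
by move=> fvE sv; split=> x d xf; apply: sv; rewrite fvE mem_cat xf ?orbT.
Qed.

Lemma preserved_And f g : preserved f -> preserved g -> preserved (And f g).
Proof.
move=> pf pg s v sl sv; have [svf svg] := @within_cat s v f g (And f g) erefl sv.
by have := pf s v sl svf; have := pg s v sl svg; simpl; tauto.
Qed.

Lemma preserved_Imp f g : preserved f -> preserved g -> preserved (Imp f g).
Proof.
move=> pf pg s v sl sv; have [svf svg] := @within_cat s v f g (Imp f g) erefl sv.
by have := pf s v sl svf; have := pg s v sl svg; simpl; tauto.
Qed.

(** Every quantifier rule becomes a block, whose live set comes either from a true guard or from
    having at most two free variables. *)
Lemma guarded_preserved tri f : guarded false tri f -> scoped f -> preserved f.
Proof.
elim=> {f} [r ts|t u //|f _ IH|f g _ IHf _ IHg|f g _ IHf _ IHg|f g _ IHf _ IHg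
  |f g _ IHf _ IHg|xs gd f _ gdP fg _ IH|xs gd f _ gdP fg _ IH|x y f fy _ IH
  |x y f fy _ IH|x y f _ fy _ IH|x y f _ fy _ IH] okf.
- exact: preserved_rel.
- have okf' : scoped f by case: okf => a b; split=> // g gf; apply: a; right.
  by move=> s v sl sv /=; have := IH okf' s v sl sv; tauto.
- by have [/IHf pf /IHg pg] := @scoped_binary (@And S) f g erefl erefl okf; apply: preserved_And.
- have [/IHf pf /IHg pg] := @scoped_binary (@Or S) f g erefl erefl okf.
  move=> s v sl sv; have [svf svg] := @within_cat s v f g (Or f g) erefl sv.
  by have := pf s v sl svf; have := pg s v sl svg; simpl; tauto.
- by have [/IHf pf /IHg pg] := @scoped_binary (@Imp S) f g erefl erefl okf; apply: preserved_Imp.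
- have [/IHf pf /IHg pg] := @scoped_binary (@Iff S) f g erefl erefl okf.
  move=> s v sl sv; have [svf svg] := @within_cat s v f g (Iff f g) erefl sv.
  by have := pf s v sl svf; have := pg s v sl svg; simpl; tauto.
- have [okg okf'] := @scoped_binary (@Imp S) gd f erefl erefl (scoped_all_block okf).
  apply: preserved_all_block => // [|v /= nH].
    by apply: preserved_Imp; [apply: preserved_guard|apply: IH].
  have Hg : holds patched v gd by apply: contrapT => ng; apply: nH.
  apply: (guard_live gdP okg _ Hg) => x /=.
  by rewrite mem_cat => /orP[|/fg].
- have [okg okf'] := @scoped_binary (@And S) gd f erefl erefl (scoped_ex_block okf).
  apply: preserved_ex_block => // [|v /= [Hg _]].
    by apply: preserved_And; [apply: preserved_guard|apply: IH].
  apply: (guard_live gdP okg _ Hg) => x /=.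
  by rewrite mem_cat => /orP[|/fg].
- apply: (@preserved_all_block [:: x]) => // [|v _]; first exact/IH/(scoped_All okf).
  by apply: (@two_variables_live v y y) => z /fy; rewrite !inE => ->.
- apply: (@preserved_ex_block [:: x]) => // [|v _]; first exact/IH/(scoped_Ex okf).
  by apply: (@two_variables_live v y y) => z /fy; rewrite !inE => ->.
- apply: (@preserved_all_block [:: x]) => // [|v _]; first exact/IH/(scoped_All okf).
  exact: two_variables_live fy.
- apply: (@preserved_ex_block [:: x]) => // [|v _]; first exact/IH/(scoped_Ex okf).
  exact: two_variables_live fy.
Qed.

(** A pair is supported on at most two points, hence on a live set. *)
Lemma patched_binary r : arity r = 2 ->
  (forall t : (arity r).-tuple A, rel_interp M t) ->
  forall t : (arity r).-tuple B, rel_interp patched t.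
Proof.
move=> r2 full t /=; split=> //; apply: live_small.
rewrite -[X in _ <= X]r2 -[X in _ <= X](size_tuple t) -(card_imset _ (@inl_inj D C)).
apply: leq_trans (card_size _); apply: subset_leq_card; apply/subsetP=> b.
by case/imsetP=> d; rewrite inE => dv ->.
Qed.

End Model.

(** * Witnesses and the size of the model *)

(** Colours are types over the ranks ['I_n.+1]: [n] names for the points of [u] and one for the new
    point. The colour of [s] is read back to a map on [D] through the ranks of points in [s]. *)
Lemma extension_exists (S : signature) (A : Type) (M : structure S A)
    (cs : seq (cst_sym S)) (Phi : seq (formula S)) (D : finType) (d0 : D) (a0 : A)
    (n : nat) (e0 := size Phi * (n.+1 + size cs) ^ n.+1)
    (m := (2 ^ e0) ^ (2 ^ n)) :
  (forall f, List.In f Phi -> size (fv f) <= n) -> n <= #|D| ->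
  #|D|.+1 ^ n * 2 ^ e0 * m.-1 ^ (#|D| - n) < m ^ (#|D| - n) ->
  exists prop : {set D} -> D -> A, forall (u : {set D}) c,
    live M cs Phi prop u ->
    (exists2 f, List.In f Phi & #|u| <= size (fv f)) ->
    exists2 b, b \notin u &
      live M cs Phi prop (b |: u) /\
      eqv M cs Phi (b |: u) (chart M cs Phi prop (b |: u))
        (fun x => if x == b then c else chart M cs Phi prop u x).
Proof.
move=> len leD lt_m.
pose Omega : finType :=
  {ffun 'I_(size Phi) * {ffun 'I_n.+1 -> 'I_n.+1 + 'I_(size cs)} -> bool}.
have [tp [rep repP]] :
    exists (tp : ('I_n.+1 -> A) -> Omega) (rep : Omega -> 'I_n.+1 -> A),
    forall a, eqv M cs Phi [set: 'I_n.+1] a (rep (tp a)).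
  exact: finite_types len.
have cardO : #|Omega| = 2 ^ e0.
  by rewrite card_ffun card_bool card_prod card_ffun card_sum !card_ord.
pose P : finType := ({ffun 'I_n -> option D} * Omega)%type.
(* Option-valued functions on 'I_n code all sets of at most n points, the
   empty one included. *)
pose U (p : P) := [set x | Some x \in codom p.1].
pose rank (s : {set D}) x : 'I_n.+1 := inord (index x (enum s)).
have rankE (s : {set D}) x : x \in s -> #|s| <= n.+1 -> rank s x = index x (enum s) :> nat.
  by move=> xs sn; rewrite inordK // (leq_trans _ sn) // cardE index_mem mem_enum.
(* The name [ord_max] is free for [b], as points of [U p] have ranks below [n]. *)
pose rho (p : P) b x := if x == b then ord_max else rank (U p) x.
(* The type coded in [p] names points by [rho]; the colour wanted for [b |: t] is that type renamed
   by ranks in [b |: t]. *)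
pose g (p : P) b (t : {set D}) :=
  tp (fun i : 'I_n.+1 => rep p.2 (rho p b (nth b (enum (b |: t)) i))).
have [||w wP] := @generic_colouring D P Omega (tp (fun=> a0)) n U g _ leD.
- move=> p; rewrite -(card_imset (f := @Some D) _ Some_inj).
  rewrite -[X in _ <= X]card_ord -(size_codom p.1).
  apply: leq_trans (card_size _); apply: subset_leq_card; apply/subsetP=> b.
  by case/imsetP=> d; rewrite inE => dv ->.
- by rewrite card_prod card_ffun card_option card_ord cardO.
exists (fun s x => rep (w s) (rank s x)); set prop := fun s => _.
move=> u c ul [f fP uf]; have un : #|u| <= n by apply: leq_trans (len f fP).
pose a (i : 'I_n.+1) :=
  if i == ord_max then c else chart M cs Phi prop u (nth d0 (enum u) i).
(* The code of [u], padded with [None], together with the type of its extension by [c]. *)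
pose p : P := ([ffun i : 'I_n => nth None (map Some (enum u)) i], tp a).
have Up : U p = u.
  apply/setP=> x; rewrite inE; apply/codomP/idP => [[i]|xu].
    rewrite ffunE; have [lti|gei] := ltnP i (size (enum u)).
      by rewrite (nth_map x) // => -[->]; rewrite -mem_enum mem_nth.
    by rewrite nth_default // size_map.
  have lti : index x (enum u) < n.
    by rewrite (leq_trans _ un) // cardE index_mem mem_enum.
  exists (Ordinal lti); rewrite ffunE /= (nth_map x) ?nth_index ?mem_enum //.
  by rewrite index_mem mem_enum.
have [b nbu bP] := wP p; rewrite Up in nbu bP; exists b => //.
set H := fun x => _.
have HE : eqv M cs Phi (b |: u) (rep p.2 \o rho p b) H.
  apply: (@eqv_trans _ _ _ _ _ _ _ (a \o rho p b)).
    by apply: eqv_sym; apply: eqv_comp; apply: repP.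
  apply: eqv_agree => x /setU1P xbu; rewrite /= /a /rho /H Up.
  case: (x =P b) => [_|nxb]; first by rewrite eqxx.
  have xu : x \in u by case: xbu.
  have rk : rank u x = index x (enum u) :> nat by rewrite rankE // ltnW.
  have /negbTE-> : rank u x != ord_max.
    rewrite -val_eqE /= rk neq_ltn (leq_trans _ un) //.
    by rewrite cardE index_mem mem_enum.
  by rewrite rk nth_index ?mem_enum.
apply: live_extend => // [|t tu].
  by apply: eqv_agree => x xu; rewrite /H; case: eqP => // xb; rewrite -xb xu in nbu.
apply: eqv_trans (eqv_sub (setUS _ tu) HE).
rewrite /prop bP //.
(* Ranking in [b |: t] and listing back cancel, so [a' \o rank (b |: t)] is [rep p.2 \o rho p b] on
   [b |: t]. *)
pose a' (i : 'I_n.+1) := rep p.2 (rho p b (nth b (enum (b |: t)) i)).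
apply: (@eqv_trans _ _ _ _ _ _ _ (a' \o rank (b |: t))).
  by apply: eqv_sym; apply: eqv_comp; apply: repP.
apply: eqv_agree => x xt; rewrite /= /a' rankE ?nth_index ?mem_enum //.
by rewrite cardsU1 (leq_add (leq_b1 _)) // (leq_trans (subset_leq_card tu)).
Qed.

Lemma double_exponential_bound (n s c e : nat) :
  s <= n -> c <= n -> e = s * (n.+1 + c) ^ n.+1 * 2 ^ n ->
  n + 2 ^ e * 2 ^ (4 * (e + n) + 4) + c <= 2 ^ (2 ^ ((n + 3) ^ 2)).
Proof.
move=> sn cn eE.
have nlt : n < 2 ^ n by apply: ltn_expl.
(* The factors are at most [2 ^ n], [2 ^ (n.+1 * n.+1)] and [2 ^ n], using
   [n.+1 + c <= 2 ^ n.+1]. *)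
have e_le : e <= 2 ^ (n * n + 4 * n + 1).
  have -> : n * n + 4 * n + 1 = n + n.+1 * n.+1 + n by lia.
  rewrite eE !expnD expnM !leq_mul //; first by rewrite (leq_trans sn) // ltnW.
  by rewrite leq_exp2r // expnS; lia.
have x_le : e + n <= 2 ^ (n * n + 4 * n + 2).
  have -> : n * n + 4 * n + 2 = (n * n + 4 * n + 1).+1 by lia.
  rewrite expnS mul2n -addnn leq_add // (leq_trans (ltnW nlt)) // leq_exp2l //.
  by lia.
have le1 : n + 2 ^ e * 2 ^ (4 * (e + n) + 4) + c <= 2 ^ (5 * (e + n) + 6).
  have -> : 5 * (e + n) + 6 = n + (e + (4 * (e + n) + 4)) + 2 by lia.
  rewrite !(expnD _ _ 2) (expnD _ n) -(expnD 2 e).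
  have : 0 < 2 ^ (e + (4 * (e + n) + 4)) by rewrite expn_gt0.
  by move: (2 ^ (e + _)) (2 ^ n) nlt => y z; nia.
apply: leq_trans le1 _; rewrite leq_exp2l //.
have -> : (n + 3) ^ 2 = (n * n + 4 * n + 2) + (2 * n + 3) + 4.
  by rewrite -mulnn; lia.
have pos : 0 < 2 ^ (n * n + 4 * n + 2 + (2 * n + 3)) by rewrite expn_gt0.
have le2 : e + n <= 2 ^ (n * n + 4 * n + 2 + (2 * n + 3)).
  by apply: leq_trans x_le _; rewrite leq_exp2l // leq_addr.
rewrite (expnD _ _ 4).
by move: (2 ^ (n * n + _ + _ + _)) pos le2 => y; lia.
Qed.

(** One construction serves both fragments: [tri] is arbitrary, and full binary relations stay full,
    which makes the model [U]-biquitous when [M] is. *)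
Lemma guarded_small_model (S : signature) tri (f : formula S) (A : Type)
    (M : structure S A) :
  guarded false tri f -> sentence f -> models M f ->
  exists (B : finType) (M' : structure S B),
    [/\ models M' f, #|B| <= 2 ^ (2 ^ ((flen f + 3) ^ 2)) &
      forall r, arity r = 2 ->
      (forall t : (arity r).-tuple A, rel_interp M t) ->
      forall t : (arity r).-tuple B, rel_interp M' t].
Proof.
move=> gf sf Mf; have [a0] := domain_inhabited M.
pose n := flen f; pose cs := csts f; pose Phi := subs f.
have s_le : size Phi <= n by apply: size_subs.
have c_le : size cs <= n by apply: size_csts.
pose e := size Phi * (n.+1 + size cs) ^ n.+1 * 2 ^ n.
have bound := double_exponential_bound s_le c_le (erefl e).
(* The domain size for which [colouring_size] applies, with [M = 2 ^ e]. *)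
set N := n + 2 ^ e * _ in bound.
have N_gt0 : 0 < N by rewrite addn_gt0 muln_gt0 !expn_gt0 orbT.
pose D : finType := 'I_N; pose d0 : D := Ordinal N_gt0.
have [||| prop propP] := @extension_exists S A M cs Phi D d0 a0 n.
- by move=> g gP; apply: leq_trans (size_fv g) (flen_subs gP).
- by rewrite card_ord leq_addr.
- by rewrite card_ord -expnM; apply: (@colouring_size _ _ e).
have [cB cBP] : {cB : cst_sym S -> D + 'I_(size cs) & forall c, List.In c cs ->
    exists2 i, cB c = inr i & tnth (in_tuple cs) i = c}.
  apply: (@choice _ _ (fun c b => List.In c cs ->
    exists2 i, b = inr i & tnth (in_tuple cs) i = c)) => c.
  (* Constants that do not occur in [f] go to the default [d0]. *)
  have [cin|nc] := pselect (List.In c cs); last by exists (inl d0).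
  have [i ci] := In_tnth cin.
  by exists (inr i) => _; exists i.
exists (D + 'I_(size cs))%type, (patched M Phi prop d0 cB); split.
- move=> v; have okf : scoped cs Phi f by split.
  have pres := guarded_preserved d0 cBP propP gf okf.
  (* A sentence uses no points, so the live set can be empty. *)
  apply/(pres set0 v); last exact: Mf.
    by apply: live_small; rewrite cards0.
  by move=> x d; rewrite sf.
- by rewrite card_sum !card_ord.
- exact: patched_binary.
Qed.

Theorem theorem5 :
  exists p : {poly nat},
    (forall (S : signature) (f : formula S),
        TGF f -> sentence f -> satisfiable f ->
        exists (A : finType) (M : structure S A),
          models M f /\ #|A| <= 2 ^ (2 ^ (p.[flen f])%R))
    /\
    (forall (S : Usignature) (f : formula S),
        GFU f -> sentence f ->
        (exists (A : Type) (M : structure S A), U_biquitous M /\ models M f) ->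
        exists (A : finType) (M : structure S A),
          [/\ U_biquitous M, models M f
            & #|A| <= 2 ^ (2 ^ (p.[flen f])%R)]).
Proof.
exists (('X + 3%:P) ^+ 2)%R.
have pE n : ((('X + 3%:P) ^+ 2 : {poly nat}).[n])%R = (n + 3) ^ 2.
  by rewrite horner_exp hornerD hornerX hornerC.
split=> S f gf sf [A [M]].
  move=> Mf; have [B [M' [M'f leB _]]] := guarded_small_model gf sf Mf.
  by exists B, M'; rewrite pE.
case=> UM Mf; have [B [M' [M'f leB UM']]] := guarded_small_model gf sf Mf.
exists B, M'; rewrite pE; split=> //.
exact: UM' (U_binary S) UM.
Qed.
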